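(* Let $f\colon K\to M$ and $g\colon L\to N$ be simplicial maps between finite connected simplicial complexes. Then $$\mathrm{scat}(f\times g)\leq(\mathrm{scat}(f)+1)(\mathrm{scat}(g)+1)-1,$$ where $f\times g\colon K\times L\to M\times N$ is the product map between categorical products.
   Context: Simplicial complexes are abstract, finite and (edge-path) connected; subcomplexes of a given complex (e.g. members of covers) are not required to be connected. A simplicial map $f\colon K\to L$ is a map of vertex sets sending simplices to simplices. Simplicial maps $f,g\colon K\to L$ are contiguous, $f\sim_c g$, if $f(\sigma)\cup g(\sigma)$ is a simplex of $L$ for every simplex $\sigma$ of $K$. They are in the same contiguity class, $f\sim g$, if there are simplicial maps $f=f_0\sim_c f_1\sim_c\cdots\sim_c f_m=g$ from $K$ to $L$. The symbol $*$ denotes a map sending every vertex to a single vertex of the codomain; $f\sim *$ means $f\sim c$ for some such constant map $c$. $\mathrm{scat}(f)$ is the least integer $n\ge 0$ such that the domain $K$ is a union of subcomplexes $U_0,\dots,U_n$ with $f|_{U_j}\sim *$ (as maps $U_j\to L$) for all $0\le j\le n$. The product $K\times L$ is the categorical product of simplicial complexes: its vertices are pairs $(v,w)$ with $v$ a vertex of $K$ and $w$ a vertex of $L$, and a finite nonempty set of such pairs is a simplex iff its projections to $K$ and to $L$ are simplices. The map $f\times g$ is given on vertices by $(f\times g)(v,w)=(f(v),g(w))$. *)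

(* Defs.v *)
From HB Require Import structures.
From mathcomp Require Import all_boot.

Set Implicit Arguments.
Unset Strict Implicit.
Unset Printing Implicit Defensive.

(* The type [vertex] consists exactly of the vertices: every singleton is a
   simplex.  Complexes may be empty or disconnected, as is needed for the
   subcomplexes occurring in covers; see [ccomplex] for connected ones. *)
Record complex := Complex {
  vertex :> finType;
  faces : {set {set vertex}};
  faces_neq0 : set0 \notin faces;
  faces1 : forall v : vertex, [set v] \in faces;
  faces_sub : forall A B : {set vertex},
    A \in faces -> B \subset A -> B != set0 -> B \in faces
}.

Definition edge (K : complex) : rel K := fun u v => [set u; v] \in faces K.

(* [edge] also relates each vertex to itself, which does not affect its
   reflexive transitive closure. *)
Definition connected (K : complex) : bool :=
  (0 < #|K|) && [forall u : K, forall v : K, connect (@edge K) u v].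

Record ccomplex := CComplex {
  complex_of :> complex;
  ccomplexP : connected complex_of
}.

Definition is_simplicial (K L : complex) (f : {ffun K -> L}) : bool :=
  [forall A in faces K, f @: A \in faces L].

Record smap (K L : complex) := SMap {
  smap_fun :> {ffun K -> L};
  smapP : is_simplicial smap_fun
}.

HB.instance Definition _ (K L : complex) := [isSub for @smap_fun K L].
HB.instance Definition _ (K L : complex) := [Finite of smap K L by <:].

Definition contiguous (K L : complex) : rel (smap K L) :=
  fun f g => [forall A in faces K, f @: A :|: g @: A \in faces L].

Definition contiguity_class (K L : complex) : rel (smap K L) :=
  connect (@contiguous K L).

Lemma faces_nonempty (K : complex) (A : {set K}) : A \in faces K -> A != set0.
Proof. by apply: contraTneq => ->; exact: faces_neq0. Qed.

Lemma imset_const (T S : finType) (w : S) (A : {set T}) :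
  A != set0 -> [set w | _ in A] = [set w].
Proof.
case/set0Pn=> x Ax; apply/setP=> y; rewrite inE.
by apply/imsetP/eqP => [[]//|->]; exists x.
Qed.

Lemma const_smap_subproof (K L : complex) (w : L) :
  is_simplicial (K := K) [ffun => w].
Proof.
apply/forall_inP=> A KA; rewrite (eq_imset _ (ffunE _)).
by rewrite imset_const ?faces1 ?faces_nonempty.
Qed.

Definition const_smap (K L : complex) (w : L) : smap K L :=
  SMap (const_smap_subproof K w).

Definition null (K L : complex) (f : smap K L) : bool :=
  [exists w : L, contiguity_class f (const_smap K w)].

Definition is_subcomplex (K : complex) (U : {set {set K}}) : bool :=
  (U \subset faces K) &&
  [forall A in U, forall B : {set K},
     (B \subset A) && (B != set0) ==> (B \in U)].

Record subcomplex (K : complex) := SubComplex {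
  sub_faces : {set {set K}};
  subcomplexP : is_subcomplex sub_faces
}.

HB.instance Definition _ (K : complex) := [isSub for @sub_faces K].
HB.instance Definition _ (K : complex) := [Finite of subcomplex K by <:].

Section ComplexOfSub.
Variables (K : complex) (U : subcomplex K).

Definition sub_vertex : finType := {v : K | [set v] \in sub_faces U}.

Definition sub_vertex_faces : {set {set sub_vertex}} :=
  [set A : {set sub_vertex} | [set val v | v in A] \in sub_faces U].

Lemma sub_vertex_faces_neq0 : set0 \notin sub_vertex_faces.
Proof.
rewrite inE imset0; have /andP[/subsetP sUK _] := subcomplexP U.
by apply: contra (faces_neq0 K) => /sUK.
Qed.

Lemma sub_vertex_faces1 (v : sub_vertex) : [set v] \in sub_vertex_faces.
Proof. by rewrite inE imset_set1; exact: (valP v). Qed.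

Lemma sub_vertex_faces_sub (A B : {set sub_vertex}) :
  A \in sub_vertex_faces -> B \subset A -> B != set0 ->
  B \in sub_vertex_faces.
Proof.
rewrite !inE => UA sBA nzB; have /andP[_ /forall_inP clU] := subcomplexP U.
move/forallP/(_ [set val v | v in B])/implyP: (clU _ UA); apply.
by rewrite imsetS // imset_eq0.
Qed.

Definition complex_of_sub : complex :=
  Complex sub_vertex_faces_neq0 sub_vertex_faces1 sub_vertex_faces_sub.

End ComplexOfSub.

Coercion complex_of_sub : subcomplex >-> complex.

Section Restriction.
Variables (K L : complex) (f : smap K L) (U : subcomplex K).

Lemma restrict_subproof :
  is_simplicial (K := U) [ffun v : U => f (val v)].
Proof.
apply/forall_inP=> A; rewrite inE => UA; rewrite (eq_imset _ (ffunE _)).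
rewrite (imset_comp f val); have /andP[/subsetP sUK _] := subcomplexP U.
exact: (forall_inP (smapP f)) (sUK _ UA).
Qed.

Definition restrict : smap U L := SMap restrict_subproof.

End Restriction.

Definition has_null_cover (K L : complex) (f : smap K L) (n : nat) : bool :=
  [exists U : {ffun 'I_n.+1 -> subcomplex K},
     (\bigcup_(j < n.+1) sub_faces (U j) == faces K) &&
     [forall j, null (restrict f (U j))]].

Section ClosedSimplex.
Variables (K : complex) (A : {set K}).
Hypothesis KA : A \in faces K.

Lemma closed_simplex_subproof :
  is_subcomplex [set B : {set K} | (B \subset A) && (B != set0)].
Proof.
apply/andP; split.
  by apply/subsetP=> B; rewrite inE => /andP[sBA]; exact: (faces_sub KA).
apply/forall_inP=> B; rewrite inE => /andP[sBA _]; apply/forallP=> C.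
by apply/implyP=> /andP[sCB nzC]; rewrite inE nzC (subset_trans sCB).
Qed.

Definition closed_simplex : subcomplex K := SubComplex closed_simplex_subproof.

Lemma null_closed_simplex (L : complex) (f : smap K L) :
  null (restrict f closed_simplex).
Proof.
have /set0Pn[v Av] := faces_nonempty KA.
apply/existsP; exists (f v); apply: connect1; apply/forall_inP=> B UB.
have nzB := faces_nonempty UB; move: UB; rewrite inE /= inE => /andP[sBA _].
apply: (faces_sub (forall_inP (smapP f) _ KA)).
  rewrite subUset; apply/andP; split; apply/subsetP=> y /imsetP[x Bx ->].
    rewrite ffunE; apply: imset_f; apply: (subsetP sBA); exact: imset_f.
  by rewrite ffunE imset_f.
case/set0Pn: nzB => x Bx; apply/set0Pn.
by exists (restrict f closed_simplex x); rewrite inE imset_f.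
Qed.

End ClosedSimplex.

Lemma ex_null_cover (K : ccomplex) (L : complex) (f : smap K L) :
  exists n, has_null_cover f n.
Proof.
have /andP[/card_gt0P[v0 _] _] := ccomplexP K.
pose A0 := exist (fun A => A \in faces K) [set v0] (faces1 v0).
pose T : finType := {A : {set K} | A \in faces K}.
exists #|T|; apply/existsP.
pose a (j : 'I_#|T|.+1) : T := nth A0 (enum T) j.
exists [ffun j => closed_simplex (valP (a j))]; apply/andP; split; last first.
  by apply/forallP=> j; rewrite ffunE null_closed_simplex.
rewrite eqEsubset; apply/andP; split.
  apply/bigcupsP=> j _.
  by case/andP: (subcomplexP ([ffun j => closed_simplex (valP (a j))] j)).
apply/subsetP=> A KA; pose x : T := exist _ A KA.
have lt_x : index x (enum T) < #|T|.+1.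
  by rewrite ltnS cardE index_size.
apply/bigcupP; exists (Ordinal lt_x) => //; rewrite ffunE inE.
by rewrite /a nth_index ?mem_enum //= subxx faces_nonempty.
Qed.

Definition scat (K L : ccomplex) (f : smap K L) : nat :=
  ex_minn (ex_null_cover f).

Section Product.
Variables K L : complex.

Definition prod_faces : {set {set K * L}} :=
  [set A : {set K * L} |
     ([set p.1 | p in A] \in faces K) && ([set p.2 | p in A] \in faces L)].

Lemma prod_faces_neq0 : set0 \notin prod_faces.
Proof. by rewrite inE !imset0 (negPf (faces_neq0 K)). Qed.

Lemma prod_faces1 (p : K * L) : [set p] \in prod_faces.
Proof. by rewrite inE !imset_set1 !faces1. Qed.

Lemma prod_faces_sub (A B : {set K * L}) :
  A \in prod_faces -> B \subset A -> B != set0 -> B \in prod_faces.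
Proof.
rewrite !inE => /andP[A1 A2] sBA nzB.
by rewrite (faces_sub A1) ?(faces_sub A2) ?imsetS ?imset_eq0.
Qed.

Definition prod_complex : complex :=
  Complex prod_faces_neq0 prod_faces1 prod_faces_sub.

End Product.

Lemma prod_connected (K L : ccomplex) : connected (prod_complex K L).
Proof.
have /andP[K0 /forallP cK] := ccomplexP K.
have /andP[L0 /forallP cL] := ccomplexP L.
apply/andP; split; first by rewrite card_prod muln_gt0 K0.
apply/forallP=> -[u u']; apply/forallP=> -[v v'].
apply: (@connect_trans _ _ (v, u')).
  have /connectP[p + ->] := forallP (cK u) v.
  elim: p u => [|w p IHp] u //= /andP[e_uw /IHp]; apply: connect_trans.
  apply: connect1; rewrite /edge inE !imsetU1 !imset_set1 /= setUid faces1.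
  by rewrite andbT.
have /connectP[p + ->] := forallP (cL u') v'.
elim: p u' => [|w p IHp] u' //= /andP[e_uw /IHp]; apply: connect_trans.
by apply: connect1; rewrite /edge inE !imsetU1 !imset_set1 /= setUid faces1.
Qed.

Canonical prod_ccomplex (K L : ccomplex) : ccomplex :=
  CComplex (prod_connected K L).

Section ProdMap.
Variables (K L M N : complex) (f : smap K M) (g : smap L N).

Lemma prod_smap_subproof :
  is_simplicial (K := prod_complex K L) (L := prod_complex M N)
    [ffun p : K * L => (f p.1, g p.2)].
Proof.
apply/forall_inP=> A; rewrite inE => /andP[A1 A2].
rewrite (eq_imset _ (ffunE _)) inE -!imset_comp.
rewrite (imset_comp f fst) (imset_comp g snd).
by rewrite (forall_inP (smapP f)) ?(forall_inP (smapP g)).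
Qed.

Definition prod_smap : smap (prod_complex K L) (prod_complex M N) :=
  SMap prod_smap_subproof.

End ProdMap.

(* Main.v *)
Require Import Defs.
From mathcomp Require Import all_boot.

(* The products U_i x V_j of the members of null covers for f and g cover
   K x L.  On U_i x V_j the map f x g is the pairing of f|U_i and g|V_j
   precomposed with the two projections, and both precomposition and pairing
   (one coordinate at a time) preserve contiguity classes. *)

Set Implicit Arguments.
Unset Strict Implicit.
Unset Printing Implicit Defensive.

(** Since [contiguity_class] is the reflexive transitive closure of [contiguous], this reduces
    invariance under whole contiguity classes to a check on single contiguity steps. *)
Lemma connect_homo (S T : finType) (r : rel S) (e : rel T) (F : S -> T) :
  {homo F : x y / r x y >-> e x y} ->
  {homo F : x y / connect r x y >-> connect e x y}.
Proof.
move=> hF x y /connectP[p + ->]; elim: p x => //= z p IHp x /andP[/hF xz zp].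
exact: connect_trans (connect1 xz) (IHp z zp).
Qed.

Lemma smap_ext (K L : complex) (f g : smap K L) : f =1 g -> f = g.
Proof. by move=> fg; apply/val_inj/ffunP. Qed.

(** Lets one coordinate of a pairing stay fixed while the other moves by a contiguity step. *)
Lemma contiguous_refl (K L : complex) (f : smap K L) : contiguous f f.
Proof. by apply/forall_inP=> A KA; rewrite setUid (forall_inP (smapP f)). Qed.

Lemma comp_smap_subproof (K L M : complex) (g : smap L M) (f : smap K L) :
  is_simplicial (K := K) (L := M) [ffun v => g (f v)].
Proof.
apply/forall_inP=> A KA; rewrite (eq_imset _ (ffunE _)) (imset_comp g f).
exact/(forall_inP (smapP g))/(forall_inP (smapP f)).
Qed.

Definition comp_smap (K L M : complex) (g : smap L M) (f : smap K L) :=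
  SMap (comp_smap_subproof g f).

Lemma contiguity_class_comp (K L M : complex) (g h : smap L M) (f : smap K L) :
  contiguity_class g h ->
  contiguity_class (comp_smap g f) (comp_smap h f).
Proof.
apply: (connect_homo (F := fun k : smap L M => comp_smap k f)) => {}g {}h gh.
apply/forall_inP=> A KA.
rewrite !(eq_imset _ (ffunE _)) (imset_comp g f) (imset_comp h f).
exact/(forall_inP gh)/(forall_inP (smapP f)).
Qed.

Lemma null_comp (K L M : complex) (g : smap L M) (f : smap K L) :
  null g -> null (comp_smap g f).
Proof.
case/existsP=> w gw; apply/existsP; exists w.
(* A constant map precomposed with [f] is again constant, so the chain from [g] to its constant is
   carried to a chain of the required form. *)
suff <- : comp_smap (const_smap L w) f = const_smap K w.
  exact: contiguity_class_comp.
by apply: smap_ext => v; rewrite !ffunE.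
Qed.

Section Pairing.
Variables (X M N : complex).

Lemma pair_smap_subproof (f : smap X M) (g : smap X N) :
  is_simplicial (K := X) (L := prod_complex M N) [ffun v => (f v, g v)].
Proof.
apply/forall_inP=> A XA; rewrite (eq_imset _ (ffunE _)) inE -!imset_comp.
by rewrite (forall_inP (smapP f)) ?(forall_inP (smapP g)).
Qed.

Definition pair_smap (f : smap X M) (g : smap X N) :=
  SMap (pair_smap_subproof f g).

Lemma contiguous_pair (f f' : smap X M) (g g' : smap X N) :
  contiguous f f' -> contiguous g g' ->
  contiguous (pair_smap f g) (pair_smap f' g').
Proof.
move=> ff' gg'; apply/forall_inP=> A XA.
rewrite !(eq_imset _ (ffunE _)) inE !imsetU -!imset_comp.
by rewrite (forall_inP ff') ?(forall_inP gg').
Qed.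

(** The two chains may have different lengths, so they are run one after the other, through
    [pair_smap f' g]. *)
Lemma contiguity_class_pair (f f' : smap X M) (g g' : smap X N) :
  contiguity_class f f' -> contiguity_class g g' ->
  contiguity_class (pair_smap f g) (pair_smap f' g').
Proof.
move=> ff' gg'; apply: (@connect_trans _ _ (pair_smap f' g)).
  apply: (connect_homo (F := pair_smap^~ g)) ff' => h h' hh'.
  exact: contiguous_pair hh' (contiguous_refl g).
apply: (connect_homo (F := pair_smap f')) gg' => h h' hh'.
exact: contiguous_pair (contiguous_refl f') hh'.
Qed.

Lemma null_pair (f : smap X M) (g : smap X N) :
  null f -> null g -> null (pair_smap f g).
Proof.
case/existsP=> v fv /existsP[w gw]; apply/existsP; exists (v, w).
suff <- : pair_smap (const_smap X v) (const_smap X w)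
          = const_smap X ((v, w) : prod_complex M N).
  exact: contiguity_class_pair.
by apply: smap_ext => x; rewrite !ffunE.
Qed.

End Pairing.

Section ProdSubcomplex.
Variables (K L : complex) (U : subcomplex K) (V : subcomplex L).

(** The faces are sets of pairs in [K * L], not in the product of the vertex subtypes of [U] and
    [V]: a member of a cover must be a subcomplex of [prod_complex K L] itself. *)
Lemma prod_sub_subproof :
  is_subcomplex (K := prod_complex K L)
    [set A : {set K * L} | ([set p.1 | p in A] \in sub_faces U) &&
                           ([set p.2 | p in A] \in sub_faces V)].
Proof.
have /andP[/subsetP sUK /forall_inP clU] := subcomplexP U.
have /andP[/subsetP sVL /forall_inP clV] := subcomplexP V.
apply/andP; split.
  by apply/subsetP=> A; rewrite !inE => /andP[/sUK-> /sVL->].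
apply/forall_inP=> A; rewrite inE => /andP[/clU/forallP UA /clV/forallP VA].
apply/forallP=> B; apply/implyP=> /andP[sBA nzB]; rewrite inE.
by rewrite (implyP (UA _)) ?(implyP (VA _)) ?imsetS ?imset_eq0.
Qed.

Definition prod_sub : subcomplex (prod_complex K L) :=
  SubComplex prod_sub_subproof.

(** Supplies the membership proof needed for the first projection to take values in the vertex
    subtype of [U]. *)
Lemma prod_sub_fst (p : prod_sub) : [set (val p).1] \in sub_faces U.
Proof. by have:= valP p; rewrite inE !imset_set1 => /andP[]. Qed.

Lemma prod_sub_snd (p : prod_sub) : [set (val p).2] \in sub_faces V.
Proof. by have:= valP p; rewrite inE !imset_set1 => /andP[]. Qed.

Lemma fst_smap_subproof :
  is_simplicial (K := prod_sub) (L := U)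
    [ffun p : prod_sub => exist _ (val p).1 (prod_sub_fst p)].
Proof.
apply/forall_inP=> A; rewrite !inE -!imset_comp => /andP[UA _].
by rewrite (eq_imset _ (g := fun p : prod_sub => (val p).1)) // => p /=;
  rewrite ffunE.
Qed.

Lemma snd_smap_subproof :
  is_simplicial (K := prod_sub) (L := V)
    [ffun p : prod_sub => exist _ (val p).2 (prod_sub_snd p)].
Proof.
apply/forall_inP=> A; rewrite !inE -!imset_comp => /andP[_ VA].
by rewrite (eq_imset _ (g := fun p : prod_sub => (val p).2)) // => p /=;
  rewrite ffunE.
Qed.

Lemma null_restrict_prod (M N : complex) (f : smap K M) (g : smap L N) :
  null (restrict f U) -> null (restrict g V) ->
  null (restrict (prod_smap f g) prod_sub).
Proof.
move=> nf ng.
pose f' := comp_smap (restrict f U) (SMap fst_smap_subproof).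
pose g' := comp_smap (restrict g V) (SMap snd_smap_subproof).
suff -> : restrict (prod_smap f g) prod_sub = pair_smap f' g'.
  by apply: null_pair; apply: null_comp.
by apply: smap_ext => p; rewrite !ffunE.
Qed.

End ProdSubcomplex.

(** Allows a cover indexed by pairs: [enum_val] and [enum_rank] transport any finite index type of
    the right size to the ordinals. *)
Lemma has_null_cover_fin (K L : complex) (f : smap K L) (n : nat)
    (I : finType) (U : I -> subcomplex K) :
  #|I| = n.+1 -> \bigcup_i sub_faces (U i) = faces K ->
  (forall i, null (restrict f (U i))) -> has_null_cover f n.
Proof.
move=> cI covU nU; apply/existsP.
exists [ffun j => U (enum_val (cast_ord (esym cI) j))].
apply/andP; split; last by apply/forallP=> j; rewrite ffunE.
rewrite -covU; apply/eqP/setP=> A; apply/bigcupP/bigcupP=> -[i _].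
  by rewrite ffunE => UA; exists (enum_val (cast_ord (esym cI) i)).
move=> UA; exists (cast_ord cI (enum_rank i)) => //.
by rewrite ffunE cast_ordK enum_rankK.
Qed.

Lemma has_null_cover_prod (K L M N : complex) (f : smap K M) (g : smap L N)
    (m n : nat) :
  has_null_cover f m -> has_null_cover g n ->
  has_null_cover (prod_smap f g) ((m + 1) * (n + 1) - 1).
Proof.
case/existsP=> U /andP[/eqP covU /forallP nU].
case/existsP=> V /andP[/eqP covV /forallP nV].
apply: (@has_null_cover_fin (prod_complex K L) _ _ _ ('I_m.+1 * 'I_n.+1)%type
          (fun ij => prod_sub (U ij.1) (V ij.2))).
(* The number of pairs is positive, so the truncated subtraction loses nothing. *)
- by rewrite card_prod !card_ord !addn1 mulSn addSn subn1.
(* The indices for the two projections of [A] are chosen independently; together they give one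
   product containing [A]. *)
- apply/setP=> A; rewrite [in RHS]inE -covU -covV.
  apply/bigcupP/andP=> [[[i j] _]|[/bigcupP[i _ Ui] /bigcupP[j _ Vj]]].
    by rewrite inE => /andP[Ui Vj]; split; apply/bigcupP; [exists i|exists j].
  by exists (i, j); rewrite // inE Ui Vj.
- by case=> i j; apply: null_restrict_prod.
Qed.

Theorem theorem24 (K L M N : ccomplex) (f : smap K M) (g : smap L N) :
  scat (prod_smap f g) <= (scat f + 1) * (scat g + 1) - 1.
Proof.
(* Minimality of the left side leaves only a null cover with the stated index to exhibit; the minima
   on the right provide the covers to multiply. *)
rewrite /scat; case: ex_minnP => k _; apply.
case: ex_minnP => m mf _; case: ex_minnP => n ng _.
exact: has_null_cover_prod.
Qed.
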